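(* Let $\sigma$ be a surjective endomorphism of $(X,\mathcal B,\mu)$ with $\mu$ quasi-invariant with respect to $\sigma$, let $R=(R,\sigma)$ be a normalized transfer operator, and let $E(f)=R(f)\circ\sigma$. Then the operator $E$ coincides with $\mathbb E_\sigma=S_\sigma S_\sigma^*$ in $L^2(\mu)$ if and only if $$R(f)\,\frac{d(\mu\circ\sigma^{-1})}{d\mu}=\frac{(f\,d\mu)\circ\sigma^{-1}}{d\mu},\qquad f\in L^2(\mu).$$ This relation can also be written as $\rho_\mu R(f)=S_\sigma^*(f)$.
   Context: $(X,\mathcal B)$ is a standard Borel space, $\mu$ a non-atomic Borel probability measure, and $\sigma:X\to X$ a measurable surjection; $(\mu\circ\sigma^{-1})(A)=\mu(\sigma^{-1}(A))$, and quasi-invariance means $\mu(A)=0\Leftrightarrow\mu(\sigma^{-1}(A))=0$ for $A\in\mathcal B$. $\mathcal F(X,\mathcal B)$ is the set of bounded real-valued Borel functions. A transfer operator $(R,\sigma)$ is a linear map $R:\mathcal F(X,\mathcal B)\to\mathcal F(X,\mathcal B)$ that is positive ($f\ge0\Rightarrow R(f)\ge0$) and satisfies the pull-out property $R((f\circ\sigma)g)=fR(g)$; it is normalized if $R(\mathbf 1)=\mathbf 1$, where $\mathbf 1$ is the constant function 1. In the statement, $R$ and $E$ are considered as acting in $L^2(\mu)$. $S_\sigma f=f\circ\sigma$ is the composition operator and $S_\sigma^*$ its adjoint in $L^2(\mu)$, given by $S_\sigma^*(f)=\frac{(f\,d\mu)\circ\sigma^{-1}}{d\mu}$, the Radon–Nikodym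 derivative with respect to $\mu$ of $A\mapsto\int_{\sigma^{-1}(A)}f\,d\mu$. $\rho_\mu=\frac{d(\mu\circ\sigma^{-1})}{d\mu}$. $\mathbb E_\sigma$ denotes the conditional expectation from $L^2(\mu)$ onto the $\sigma^{-1}(\mathcal B)$-measurable functions in $L^2(\mu)$, where $\sigma^{-1}(\mathcal B)=\{\sigma^{-1}(B):B\in\mathcal B\}$; in the statement it is written as $S_\sigma S_\sigma^*$. Equalities of functions are understood $\mu$-a.e.
   Formalization: The identification of the conditional expectation with S_σ S_σ^* is dropped: with the adjoint taken in L^2(μ) it fails unless ρ_μ = 1 (apply both to the constant 1). The equivalence is stated for the conditional expectation onto σ^{-1}(B)-measurable functions. *)

(* Defs.v *)
(* MathComp-Analysis *)
From HB Require Import structures.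
From mathcomp Require Import all_boot all_order all_algebra.
From mathcomp Require Import all_classical all_reals all_analysis.

Set Implicit Arguments.
Unset Strict Implicit.
Unset Printing Implicit Defensive.

Import Order.TTheory GRing.Theory Num.Theory.
Import numFieldNormedType.Exports.

Local Open Scope classical_set_scope.
Local Open Scope ring_scope.
Local Open Scope charge_scope.

(* A complete, Hausdorff, second countable (pseudo)metric space is a Polish
   space. *)
Definition standard_borel (K : realType) d (X : measurableType d) : Prop :=
  exists (P : completePseudoMetricType K) (g : X -> P),
    [/\ hausdorff_space P, @second_countable P, bijective g &
        @measurable d X = preimage_set_system setT g <<s open >>].

Section Spaces.
Context d (X : measurableType d) (K : realType).
Implicit Types (mu : probability X K) (sigma : X -> X) (f g : X -> K).
Implicit Type T : (X -> K) -> (X -> K).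

Definition nonatomic mu : Prop :=
  forall A, measurable A -> (0 < mu A)%E ->
    exists B, [/\ measurable B, B `<=` A, (0 < mu B)%E & (mu B < mu A)%E].

Definition quasi_invariant mu sigma : Prop :=
  forall A, measurable A -> (mu A = 0%E <-> mu (sigma @^-1` A) = 0%E).

Definition bounded_borel f : Prop := measurable_fun setT f /\ bounded_fun f.

(* Operators on spaces of functions are total maps (X -> K) -> (X -> K); only
   their values on the relevant space are constrained. *)
Record transfer_operator sigma T : Prop := TransferOperator {
  transfer_bounded : forall f, bounded_borel f -> bounded_borel (T f) ;
  transfer_linear : forall (a : K) f g, bounded_borel f -> bounded_borel g ->
    T (a \*o f \+ g) = a \*o T f \+ T g ;
  transfer_pos : forall f, bounded_borel f ->
    (forall x, 0 <= f x) -> forall x, 0 <= T f x ;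
  transfer_pullout : forall f g, bounded_borel f -> bounded_borel g ->
    T ((f \o sigma) \* g) = f \* T g }.

Definition normalized T : Prop := T (cst 1) = cst 1.

(* T induces a positive linear operator L^2(mu) -> L^2(mu), elements of
   L^2(mu) being given by representatives.  Such an operator is automatically
   continuous, hence determined by its values on bounded_borel functions, which
   are dense in L^2(mu). *)
Record acts_in_L2 mu T : Prop := ActsInL2 {
  L2_stable : forall f, f \in Lfun mu 2%:E -> T f \in Lfun mu 2%:E ;
  L2_ae : forall f g, f \in Lfun mu 2%:E -> g \in Lfun mu 2%:E ->
    ae_eq mu setT f g -> ae_eq mu setT (T f) (T g) ;
  L2_linear : forall (a : K) f g,
    f \in Lfun mu 2%:E -> g \in Lfun mu 2%:E ->
    ae_eq mu setT (T (a \*o f \+ g)) (a \*o T f \+ T g) ;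
  L2_pos : forall f, f \in Lfun mu 2%:E ->
    {ae mu, forall x, 0 <= f x} -> {ae mu, forall x, 0 <= T f x} }.

Definition pullback_transfer sigma T : (X -> K) -> (X -> K) :=
  fun f => T f \o sigma.

Definition sigma_preimage sigma : set (set X) :=
  preimage_set_system setT sigma (@measurable d X).

(* P f is a version of the conditional expectation of f given
   sigma_preimage sigma, for every f in L^2(mu).  With S f = f \o sigma, it is
   S S^* when S is taken from L^2(mu \o sigma^-1) to L^2(mu); with the adjoint
   in L^2(mu), as in composition_adjoint below, P = S S^* / (rho \o sigma),
   which is S S^* only for invariant mu. *)
Definition cond_expectation mu sigma (P : (X -> K) -> (X -> K)) : Prop :=
  forall f, f \in Lfun mu 2%:E ->
    [/\ P f \in Lfun mu 2%:E,
        forall B : set K, measurable B -> sigma_preimage sigma (P f @^-1` B) &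
        forall A, sigma_preimage sigma A ->
          (\int[mu]_(x in A) (P f x)%:E = \int[mu]_(x in A) (f x)%:E)%E].

(* The adjoint in L^2(mu) of g |-> g \o sigma, on its natural domain
   {g in L^2(mu) | g \o sigma in L^2(mu)}.  When this operator is unbounded,
   S f need not be in L^2(mu) for all f; it is only required that its pairing
   with each g in the domain be defined (g = 1 shows that S f is
   integrable, and indicators g show that it is unique mu-a.e.). *)
Definition composition_adjoint mu sigma (S : (X -> K) -> (X -> K)) : Prop :=
  forall f, f \in Lfun mu 2%:E ->
    measurable_fun setT (S f) /\
    forall g, g \in Lfun mu 2%:E -> g \o sigma \in Lfun mu 2%:E ->
      mu.-integrable setT (EFin \o (g \* S f)) /\
      (\int[mu]_x (g (sigma x) * f x)%:E = \int[mu]_x (g x * S f x)%:E)%E.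

Lemma Lfun2_integrable mu f :
  f \in Lfun mu 2%:E -> mu.-integrable setT (EFin \o f).
Proof.
move=> /(Lfun_subset12 (fin_num_measure mu setT measurableT)).
by move=> /Lfun1_integrable.
Qed.

End Spaces.

Section RadonNikodymPushforward.
Context d (X : measurableType d) (K : realType).
Variables (mu : probability X K) (sigma : X -> X).
Hypothesis msigma : measurable_fun setT sigma.

Definition push_charge (nu : {charge set X -> \bar K}) :
  {charge set X -> \bar K} :=
  measure_function_pushforward__canonical__charge_Charge nu msigma.

Definition rho : X -> \bar K :=
  'd (push_charge (charge_of_finite_measure mu)) '/d mu.

(* The derivative of A |-> \int[mu]_(x in sigma @^-1` A) f x. *)
Definition push_density (f : X -> K) (f2 : f \in Lfun mu 2%:E) : X -> \bar K :=
  'd (push_charge (induced_charge (Lfun2_integrable f2))) '/d mu.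

End RadonNikodymPushforward.

(* Main.v *)
Require Import Defs.
From HB Require Import structures.
From mathcomp Require Import all_boot all_order all_algebra.
From mathcomp Require Import all_classical all_reals all_analysis.
From mathcomp Require Import measurable_realfun.
Import Order.TTheory GRing.Theory Num.Theory.
Import numFieldNormedType.Exports.
Local Open Scope classical_set_scope.
Local Open Scope ring_scope.

(** Quasi-invariance makes [mu \o sigma^-1] absolutely continuous, so that the
    two densities have the expected integrals, and everything reduces to
    integrals over the sets [sigma @^-1` B].  By the
    change of variables [y = sigma x] followed by the definition of [rho],
    the integral of [u * rho] over [B] is that of [u \o sigma] over
    [sigma @^-1` B]; and the integral of the density of [(f d mu) \o sigma^-1]
    over [B] is that of [f] over [sigma @^-1` B].  Hence, for [u = R f], the
    relation [rho * R f = (f d mu) \o sigma^-1 / d mu] says exactly that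
    [R f \o sigma] and [f] have the same integral over every
    [sigma @^-1` B] ([ae_eq_push_densityP]).

    As [R f \o sigma] is a function of [sigma], this is the characterisation
    of the conditional expectation of [f] given the preimages under [sigma].
    To conclude that it agrees a.e. with any other version, the latter is
    factored as [v \o sigma] ([sigma_preimage_factor]), so that the comparison
    becomes one between [R f] and [v] on the whole Borel structure, for the
    image measure [mu \o sigma^-1] ([ae_eq_comp]).

    Finally, pairing [S^* f] with indicators [\1_B] shows that it too
    integrates over [B] to the integral of [f] over [sigma @^-1` B], so that
    it is another version of the density of [(f d mu) \o sigma^-1]. *)

Set Implicit Arguments.
Unset Strict Implicit.
Unset Printing Implicit Defensive.

(** * Functions of sigma and the image measure *)

Section ChangeOfVariables.
Context d (X : measurableType d) (K : realType).
Variables (mu : probability X K) (sigma : X -> X).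
Hypothesis msigma : measurable_fun setT sigma.

Definition sigma_mfun : {mfun X >-> X} :=
  HB.pack sigma (isMeasurableFun.Build _ _ _ _ sigma msigma).

(** This is [pushforward mu sigma], in a form that carries the structure of a
    probability, which the change of variables for densities requires. *)
Definition image_law : probability X K := distribution mu sigma_mfun.

Lemma measurable_preimage A : measurable A -> measurable (sigma @^-1` A).
Proof. by move=> mA; rewrite -[X in measurable X]setTI; exact: msigma. Qed.

Lemma integral_comp (u : X -> K) B : measurable_fun setT u -> measurable B ->
  mu.-integrable setT (EFin \o (u \o sigma)) ->
  image_law.-integrable B (EFin \o u) /\
  (\int[image_law]_(y in B) (u y)%:E =
   \int[mu]_(x in sigma @^-1` B) (u (sigma x))%:E)%E.
Proof.
move=> /measurable_EFinP mu' mB iu.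
have iB : mu.-integrable (sigma @^-1` B) ((EFin \o u) \o sigma).
  by apply: integrableS iu => //; exact: measurable_preimage.
split; first exact: (integrable_pushforward msigma mu' iB mB).
exact: (integral_pushforward msigma mu' iB mB).
Qed.

(** Both integrals are integrals over [B] for the image measure, for which
    [u] and [v] are therefore a.e. equal; a null set of the image measure
    pulls back to a null set of [mu]. *)
Lemma ae_eq_comp (u v : X -> K) :
  measurable_fun setT u -> measurable_fun setT v ->
  mu.-integrable setT (EFin \o (u \o sigma)) ->
  mu.-integrable setT (EFin \o (v \o sigma)) ->
  (forall B, measurable B ->
    \int[mu]_(x in sigma @^-1` B) (u (sigma x))%:E =
    \int[mu]_(x in sigma @^-1` B) (v (sigma x))%:E)%E ->
  ae_eq mu setT (u \o sigma) (v \o sigma).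
Proof.
move=> mu' mv iu iv uv.
have [N [mN N0 uvN]] : ae_eq image_law setT (EFin \o u) (EFin \o v).
  apply: integral_ae_eq => //.
  - by have [] := integral_comp mu' measurableT iu.
  - exact/measurable_EFinP.
  - move=> B _ mB; have [_ ->] := integral_comp mu' mB iu.
    by have [_ ->] := integral_comp mv mB iv; exact: uv.
exists (sigma @^-1` N); split => //; first exact: measurable_preimage.
by move=> x /= uvx; apply: uvN => /= uvs; apply: uvx => _; case: (uvs I).
Qed.

(** A Doob-Dynkin factorisation.  The preimages of singletons show that [h] is
    constant on the fibres of [sigma], so [h = (h \o s) \o sigma] for any
    section [s] of [sigma].  Although [s] need not be measurable, [h \o s] is:
    if [h @^-1` B = sigma @^-1` C], then [(h \o s) @^-1` B = C]. *)
Lemma sigma_preimage_factor (h : X -> K) : (forall y, exists x, sigma x = y) ->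
  (forall B : set K, measurable B -> sigma_preimage sigma (h @^-1` B)) ->
  exists2 u : X -> K, measurable_fun setT u & h = u \o sigma.
Proof.
move=> /choice[s sK] hB.
have hs x : h x = h (s (sigma x)).
  have [C _ hC] := hB [set h x] (measurable_set1 _).
  have Cx : C (sigma x).
    have : (h @^-1` [set h x]) x by [].
    by rewrite -hC => -[].
  suff : (h @^-1` [set h x]) (s (sigma x)) by [].
  by rewrite -hC; split => //=; rewrite sK.
exists (h \o s); last exact/funext.
move=> _ B mB; have [C mC hC] := hB B mB.
rewrite setTI comp_preimage -hC setTI -comp_preimage.
suff -> : sigma \o s = idfun by rewrite preimage_id.
exact/funext.
Qed.

(** * Densities with respect to mu *)

Section Densities.
Hypothesis sigma_null :
  forall A, measurable A -> mu A = 0%E -> mu (sigma @^-1` A) = 0%E.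

Let image_dom : image_law `<< mu.
Proof. by apply/null_content_dominatesP => A mA; exact: sigma_null. Qed.

Lemma measurable_rho : measurable_fun setT (rho mu msigma).
Proof.
by apply: (measurable_int mu); apply: Radon_Nikodym_integrable; exact: image_dom.
Qed.

(** [rho] differentiates the image measure seen as the pushforward of a
    charge; here it is identified with the derivative of the same set function
    seen as a finite measure, to which [Radon_Nikodym_change_of_variables]
    applies. *)
Lemma rho_ae_eq :
  ae_eq mu setT (rho mu msigma)
    (Radon_Nikodym (charge_of_finite_measure image_law) mu).
Proof.
have rho_dom : push_charge msigma (charge_of_finite_measure mu) `<< mu.
  exact: image_dom.
apply: integral_ae_eq => //; first exact: Radon_Nikodym_integrable.
by move=> B _ mB; rewrite -!Radon_Nikodym_integral.
Qed.

Lemma integral_rho (u : X -> K) B : measurable_fun setT u -> measurable B ->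
  mu.-integrable setT (EFin \o (u \o sigma)) ->
  (\int[mu]_(x in B) ((u x)%:E * rho mu msigma x) =
   \int[mu]_(x in sigma @^-1` B) (u (sigma x))%:E)%E.
Proof.
move=> mu' mB iu; have [iu' <-] := integral_comp mu' mB iu.
rewrite -(Radon_Nikodym_change_of_variables image_dom mB iu').
have mEu : measurable_fun B (EFin \o u).
  exact/measurable_funTS/measurable_EFinP.
apply: ae_eq_integral => //.
- apply: emeasurable_funM => //; apply: measurable_funTS.
  exact: measurable_rho.
- by apply: emeasurable_funM => //; exact: measurable_funTS.
- by apply: ae_eqe_mul2l; exact: ae_eq_subset rho_ae_eq.
Qed.

Section PushDensity.
Variables (f : X -> K) (f2 : f \in Lfun mu 2%:E).

Let push_dom : push_charge msigma (induced_charge (Lfun2_integrable f2)) `<< mu.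
Proof.
apply/null_content_dominatesP => A mA A0; apply: null_set_integral.
- exact: measurable_preimage.
- exact/measurable_funTS/(measurable_int mu)/Lfun2_integrable.
- exact: sigma_null.
Qed.

Lemma integral_push_density B : measurable B ->
  (\int[mu]_(x in B) push_density msigma f2 x =
   \int[mu]_(x in sigma @^-1` B) (f x)%:E)%E.
Proof. by move=> mB; rewrite -Radon_Nikodym_integral. Qed.

Lemma push_density_unique (v : X -> \bar K) : measurable_fun setT v ->
  (forall B, measurable B -> \int[mu]_(x in B) v x =
    \int[mu]_(x in sigma @^-1` B) (f x)%:E)%E ->
  ae_eq mu setT v (push_density msigma f2).
Proof.
move=> mv vB; apply: ae_eq_sym; apply: integral_ae_eq => //.
  exact: Radon_Nikodym_integrable.
by move=> B _ mB; rewrite integral_push_density// vB.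
Qed.

(** The pivot of the theorem: its middle condition is thereby rewritten as the
    one that defines conditional expectations. *)
Lemma ae_eq_push_densityP (u : X -> K) : measurable_fun setT u ->
  mu.-integrable setT (EFin \o (u \o sigma)) ->
  ae_eq mu setT (fun x => (u x)%:E * rho mu msigma x)%E
    (push_density msigma f2) <->
  (forall B, measurable B ->
    \int[mu]_(x in sigma @^-1` B) (u (sigma x))%:E =
    \int[mu]_(x in sigma @^-1` B) (f x)%:E)%E.
Proof.
move=> mu' iu.
have murho : measurable_fun setT (fun x => (u x)%:E * rho mu msigma x)%E.
  by apply: emeasurable_funM; [exact/measurable_EFinP | exact: measurable_rho].
split=> [uf B mB|uf].
- rewrite -integral_rho// -integral_push_density//.
  apply: ae_eq_integral => //; first exact: measurable_funTS.
    apply/measurable_funTS/(measurable_int mu).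
    exact: Radon_Nikodym_integrable.
  exact: ae_eq_subset uf.
- by apply: push_density_unique => // B mB; rewrite integral_rho// uf.
Qed.

End PushDensity.
End Densities.

(** * The adjoint of the composition operator *)

Lemma indic_Lfun2 A : measurable A -> \1_A \in Lfun mu 2%:E.
Proof.
move=> mA; rewrite inE; apply/andP; split; rewrite inE/=.
  exact: measurable_indic.
rewrite /finite_norm unlock poweR_lty//.
have -> : (fun x => (`|\1_A x : K| `^ 2)%:E) = (fun x => (\1_A x : K)%:E).
  apply/funext => x; rewrite indicE; congr EFin.
  by case: (x \in A); rewrite ?normr1 ?powR1 ?normr0 ?powR0.
by rewrite integral_indic// setIT ltey_eq fin_num_measure.
Qed.

(** The indicator of [B] and its composition with [sigma], the indicator of
    [sigma @^-1` B], are bounded: thus [\1_B] lies in the domain of the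
    composition operator, even if the latter is unbounded. *)
Lemma integral_composition_adjoint (S : (X -> K) -> X -> K) (f : X -> K) B :
  composition_adjoint mu sigma S -> f \in Lfun mu 2%:E -> measurable B ->
  (\int[mu]_(x in B) (S f x)%:E = \int[mu]_(x in sigma @^-1` B) (f x)%:E)%E.
Proof.
move=> adjS f2 mB; have [_ /(_ \1_B)] := adjS _ f2.
case=> [||_ adjSB]; first exact: indic_Lfun2.
  exact: (indic_Lfun2 (measurable_preimage mB)).
have restr (g : X -> K) A : (EFin \o g) \_ A = (fun x => (\1_A x * g x)%:E).
  by rewrite restrict_EFin patch_indic; apply/funext => x /=; rewrite mulrC.
by rewrite integral_mkcond [RHS]integral_mkcond !restr -adjSB.
Qed.

End ChangeOfVariables.

(** * Conditional expectations and densities *)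

Theorem theorem3p16 (K : realType) (d : measure_display) (X : measurableType d)
    (mu : probability X K) (sigma : X -> X)
    (hX : standard_borel K X)
    (hmu : nonatomic mu)
    (msigma : measurable_fun setT sigma)
    (surj : forall y, exists x, sigma x = y)
    (hqi : quasi_invariant mu sigma)
    (R : (X -> K) -> (X -> K))
    (hR : transfer_operator sigma R)
    (hR1 : normalized R)
    (hR2 : acts_in_L2 mu R)
    (hE2 : acts_in_L2 mu (pullback_transfer sigma R))
    (Esigma : (X -> K) -> (X -> K))
    (hEsigma : cond_expectation mu sigma Esigma)
    (Ssigma_star : (X -> K) -> (X -> K))
    (hSstar : composition_adjoint mu sigma Ssigma_star) :
  ((forall f, f \in Lfun mu 2%:E ->
      ae_eq mu setT (pullback_transfer sigma R f) (Esigma f))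
   <->
   (forall f (f2 : f \in Lfun mu 2%:E),
      ae_eq mu setT (fun x => (R f x)%:E * rho mu msigma x)%E
        (push_density msigma f2)))
  /\
  ((forall f (f2 : f \in Lfun mu 2%:E),
      ae_eq mu setT (fun x => (R f x)%:E * rho mu msigma x)%E
        (push_density msigma f2))
   <->
   (forall f, f \in Lfun mu 2%:E ->
      ae_eq mu setT (fun x => rho mu msigma x * (R f x)%:E)%E
        (fun x => (Ssigma_star f x)%:E))).
Proof.
have null A : measurable A -> mu A = 0%E -> mu (sigma @^-1` A) = 0%E.
  by move=> mA A0; apply/(hqi A mA).
have mR f : f \in Lfun mu 2%:E -> measurable_fun setT (R f).
  move=> /(L2_stable hR2)/Lfun2_integrable/(measurable_int mu).
  by move/measurable_EFinP.
have iR f : f \in Lfun mu 2%:E -> mu.-integrable setT (EFin \o (R f \o sigma)).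
  by move=> /(L2_stable hE2)/Lfun2_integrable.
have Eint f B : f \in Lfun mu 2%:E -> measurable B ->
    (\int[mu]_(x in sigma @^-1` B) (Esigma f x)%:E =
     \int[mu]_(x in sigma @^-1` B) (f x)%:E)%E.
  move=> f2 mB; have [_ _] := hEsigma f f2; apply.
  by exists B => //; rewrite setTI.
have density_adjoint f (f2 : f \in Lfun mu 2%:E) :
    ae_eq mu setT (fun x => (Ssigma_star f x)%:E) (push_density msigma f2).
  apply: push_density_unique => //.
    by apply/measurable_EFinP; have [] := hSstar f f2.
  by move=> B mB; exact: integral_composition_adjoint.
have rhoC f : (fun x => rho mu msigma x * (R f x)%:E)%E =
    (fun x => (R f x)%:E * rho mu msigma x)%E.
  by apply/funext => x; rewrite muleC.
split; split=> H f f2.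
- apply/(ae_eq_push_densityP msigma null f2 (mR _ f2) (iR _ f2)) => B mB.
  have [/Lfun2_integrable iE _ _] := hEsigma f f2.
  have mpB := measurable_preimage msigma mB.
  rewrite -(Eint f)//; apply: ae_eq_integral => //.
  + exact/measurable_funTS/(measurable_int mu)/iR.
  + exact/measurable_funTS/(measurable_int mu)/iE.
  + apply: (@ae_eq_subset _ _ _ _ _ setT) => //.
    by apply: filterS (H f f2) => x /= Hx _; rewrite -Hx.
- have [/Lfun2_integrable + EB _] := hEsigma f f2.
  have [v mv Ev] := sigma_preimage_factor surj EB; rewrite Ev => iv.
  apply: (ae_eq_comp msigma (mR _ f2) mv (iR _ f2) iv) => B mB.
  have /(ae_eq_push_densityP msigma null f2 (mR _ f2) (iR _ f2)) -> // := H f f2.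
  by rewrite -(Eint f)// Ev.
- rewrite rhoC; apply: ae_eq_trans (H f f2) _.
  exact/ae_eq_sym/density_adjoint.
- by have := H f f2; rewrite rhoC => /ae_eq_trans; apply; exact: density_adjoint.
Qed.
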